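(* Let $L>0$ and $B_L=\{x\in\mathbb{R}:|x|<L\}$. For every compact set $A\subset B_L\subset\mathbb{R}$ with finite Minkowski perimeter $\operatorname{Per}(A)$, there exists a sequence of polarizations $A_n=A^{\sigma_1\cdots\sigma_n}$ of $A$ such that $$m(A_n\triangle A^* )\le\left(\frac{\operatorname{Per}(A)}{1+\operatorname{Per}(A)}\right)^n$$ for $n$ sufficiently large.
   Context: $m$ is Lebesgue measure on $\mathbb{R}$. $A^*$ is the open interval centered at the origin with $m(A^* )=m(A)$. The Minkowski perimeter is $\operatorname{Per}(A)=\lim_{\varepsilon\to0^+}\varepsilon^{-1}\big(m(\{x:\operatorname{dist}(x,A)<\varepsilon\})-m(A)\big)$. Polarization: a reflection $\sigma$ of $\mathbb{R}$ about a point $a\neq0$ (so $\sigma(x)=2a-x$, $\sigma(0)\neq0$) splits $\mathbb{R}\setminus\{a\}$ into the open half-line $X_+^\sigma$ containing $0$ and the other open half-line $X_-^\sigma$. $A^\sigma$ is the set whose indicator is $\max(\mathbf{1}_A(x),\mathbf{1}_A(\sigma(x)))$ on $X_+^\sigma$, $\min(\mathbf{1}_A(x),\mathbf{1}_A(\sigma(x)))$ on $X_-^\sigma$, and $\mathbf{1}_A(a)$ at $a$. $A^{\sigma_1\cdots\sigma_n}$ is the result of polarizing successively with respect to $\sigma_1,\dots,\sigma_n$, for a fixed sequence $\sigma_1,\sigma_2,\dots$ of such reflections. *)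

(* Defs.v *)
From HB Require Import structures.
From mathcomp Require Import all_boot all_order all_algebra.
From mathcomp Require Import all_classical all_reals all_analysis.

Set Implicit Arguments.
Unset Strict Implicit.
Unset Printing Implicit Defensive.

Import Order.TTheory GRing.Theory Num.Theory.
Import numFieldNormedType.Exports.

Local Open Scope classical_set_scope.
Local Open Scope ring_scope.

(* The bound is stated in the extended reals so that the definition also
   makes sense (and gives the whole line) when A has infinite measure. *)
Definition sym_rearrangement (R : realType) (A : set R) : set R :=
  [set x | ((`|x| *+ 2)%:E < lebesgue_measure A)%E].

(* edist_inf set0 is +oo everywhere, so set0 has empty neighborhoods. *)
Definition open_nbhd (R : realType) (A : set R) (e : R) : set R :=
  [set x | (edist_inf A x < e%:E)%E].

Definition perimeter_quotient (R : realType) (A : set R) (e : R) : \bar R :=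
  ((e^-1)%:E * (lebesgue_measure (open_nbhd A e) - lebesgue_measure A))%E.

(* lim is total: this is meaningful only when the limit exists, see
   finite_perimeter. *)
Definition minkowski_perimeter (R : realType) (A : set R) : \bar R :=
  lim (perimeter_quotient A e @[e --> 0^'+]).

Definition finite_perimeter (R : realType) (A : set R) : Prop :=
  cvg (perimeter_quotient A e @[e --> 0^'+]) /\
  minkowski_perimeter A \is a fin_num.

Definition reflection (R : realType) (a x : R) : R := a *+ 2 - x.

(* For a != 0 these are the open half-lines bounded by a that do,
   respectively do not, contain the origin. *)
Definition half_plus (R : realType) (a : R) : set R :=
  [set x | if 0 < a then x < a else a < x].

Definition half_minus (R : realType) (a : R) : set R :=
  [set x | if 0 < a then a < x else x < a].

(* Union and intersection with the reflected set encode the max and the min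
   of the indicators; see indic_polarization. *)
Definition polarization (R : realType) (a : R) (A : set R) : set R :=
  (half_plus a `&` (A `|` reflection a @^-1` A)) `|`
  (half_minus a `&` (A `&` reflection a @^-1` A)) `|`
  ([set a] `&` A).

Lemma indic_polarization (R : realType) (a : R) (A : set R) (x : R) :
  (half_plus a x ->
    \1_(polarization a A) x = Num.max (\1_A x) (\1_A (reflection a x)) :> R) /\
  (half_minus a x ->
    \1_(polarization a A) x = Num.min (\1_A x) (\1_A (reflection a x)) :> R) /\
  \1_(polarization a A) a = \1_A a :> R.
Proof.
have memE (B : set R) y : \1_B y = (`[< B y >])%:R :> R by rewrite indicE.
have maxE (b c : bool) : Num.max b%:R c%:R = (b || c)%:R :> R.
  by rewrite maxEle ler_nat; case: b; case: c.
have minE (b c : bool) : Num.min b%:R c%:R = (b && c)%:R :> R.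
  by rewrite minEle ler_nat; case: b; case: c.
rewrite !memE maxE minE -asbool_or -asbool_and.
have pm y : half_plus a y -> ~ half_minus a y.
  by rewrite /half_plus /half_minus /=; case: ifP => _ h k;
    have := lt_trans h k; rewrite ltxx.
have pa : ~ half_plus a a by rewrite /half_plus /=; case: ifP; rewrite ltxx.
have ma : ~ half_minus a a by rewrite /half_minus /=; case: ifP; rewrite ltxx.
split=> [xp|]; last split=> [xm|].
- congr (_%:R); congr nat_of_bool; apply: asbool_equiv_eq; split.
    by move=> [[[]|[/pm//]]|[/= xa Ax]] //; left.
  by move=> ?; left; left.
- congr (_%:R); congr nat_of_bool; apply: asbool_equiv_eq; split.
    by move=> [[[/pm//]|[]]|[/= xa _]] //; move: xm; rewrite xa => /ma.
  by move=> ?; left; right.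
congr (_%:R); congr nat_of_bool; apply: asbool_equiv_eq; split.
  by move=> [[[/pa]|[/ma]]|[]].
by move=> ?; right.
Qed.

(* The i-th reflection of the sequence (counted from 0) is the one about
   a i. *)
Fixpoint polarizations (R : realType) (a : nat -> R) (A : set R) (n : nat) :
    set R :=
  if n is k.+1 then polarization (a k) (polarizations a A k) else A.

(* Main.v *)
Require Import Defs.
From HB Require Import structures.
From mathcomp Require Import all_boot all_order all_algebra.
From mathcomp Require Import all_classical all_reals all_analysis.
From mathcomp Require Import measurable_realfun lra.

Import Order.TTheory GRing.Theory Num.Theory.
Import numFieldNormedType.Exports.

Local Open Scope classical_set_scope.
Local Open Scope ring_scope.

(* Finite perimeter forces A to have finitely many gaps: every gap ]b, c[
   contributes at least e to the measure of the e-neighborhood for small e.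
   So A is a finite union of compact intervals, and up to finite sets A* is
   reached in finitely many steps, whatever the rate on the right-hand side.
   If [c, d] is the rightmost interval and b the right end of the rest, with
   b < c and 0 < b + d, then the reflection exchanging b and d leaves the rest
   alone and slides [c, d] onto [b, b + d - c], which lowers the number of
   intervals; when d is at least the distance from 0 to the leftmost end this
   applies, and otherwise its mirror image does.  A single interval is centered
   by one more polarization, and a centered interval is then left unchanged. *)

(** * Pointwise form and mirror symmetry of polarization *)

Lemma polarization_lt {R : realType} {a : R} (A : set R) {x : R} :
  0 < a -> x < a -> polarization a A x = (A x \/ A (a *+ 2 - x)).
Proof.
move=> a0 xa; rewrite /polarization /half_plus /half_minus /reflection /= a0.
apply/propext; split=> [[[[]|[]]|[]]|?] //.
- by move=> ax; have := lt_trans ax xa; rewrite ltxx.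
- by move=> xE; move: xa; rewrite xE ltxx.
- by left; left.
Qed.

Lemma polarization_gt {R : realType} {a : R} (A : set R) {x : R} :
  0 < a -> a < x -> polarization a A x = (A x /\ A (a *+ 2 - x)).
Proof.
move=> a0 xa; rewrite /polarization /half_plus /half_minus /reflection /= a0.
apply/propext; split=> [[[[]|[]]|[]]|?] //.
- by move=> ax; have := lt_trans ax xa; rewrite ltxx.
- by move=> xE; move: xa; rewrite xE ltxx.
- by left; right.
Qed.

Lemma polarization_fix {R : realType} {a : R} (A : set R) :
  polarization a A a = A a.
Proof.
rewrite /polarization /half_plus /half_minus /reflection /=.
by case: ifP => a0; rewrite !ltxx; apply/propext; split=> [[[[]|[]]|[]]|] //;
  right.
Qed.

(** Lets every other computation assume a positive center. At [a = 0] it would fail: the convention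
    then selects the positive half-line, and negation exchanges the two sides. *)
Lemma polarizationN {R : realType} (a : R) (A : set R) : a != 0 ->
  polarization (- a) (-%R @^-1` A) = -%R @^-1` (polarization a A).
Proof.
move=> a0; have aN : (0 < - a) = ~~ (0 < a) by rewrite oppr_gt0 lt_neqAle a0 leNgt.
have hp x : half_plus (- a) x = half_plus a (- x).
  by rewrite /half_plus /= aN; case: (0 < a); rewrite /= (ltrNr, ltrNl).
have hm x : half_minus (- a) x = half_minus a (- x).
  by rewrite /half_minus /= aN; case: (0 < a); rewrite /= (ltrNr, ltrNl).
apply/funext => x; rewrite /polarization /setU /setI /preimage /mkset hp hm.
have -> : - reflection (- a) x = reflection a (- x) by rewrite /reflection; lra.
by congr (_ \/ (_ /\ _)); apply/propext; split=> /= ?; lra.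
Qed.

(** * Equality up to finitely many points *)

(** Polarizing closed intervals may leave stray endpoints behind; they form a null set and stay
    finite in number under further polarization. *)
Definition eqfin {T : Type} (A B : set T) := finite_set (A `+` B).

Lemma eqfin_sub {T : Type} {A B : set T} (E : set T) : finite_set E ->
  (forall x, ~ E x -> A x <-> B x) -> eqfin A B.
Proof.
move=> fE AB; apply: sub_finite_set fE => x; rewrite setY_def => ABx.
by apply: contrapT => /AB; case: ABx => -[]; tauto.
Qed.

Lemma eqfinE {T : Type} {A B : set T} {x : T} : ~ (A `+` B) x -> A x = B x.
Proof.
rewrite setY_def => h; apply/propext.
by split=> ?; apply: contrapT => ?; apply: h; [left|right].
Qed.

Lemma eqfin_refl {T : Type} (A : set T) : eqfin A A.
Proof. by rewrite /eqfin setYK. Qed.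

Lemma eqfin_trans {T : Type} {A B C : set T} :
  eqfin A B -> eqfin B C -> eqfin A C.
Proof.
move=> AB BC; apply: (eqfin_sub ((A `+` B) `|` (B `+` C))).
  by rewrite finite_setU.
by move=> x /not_orP[nAB nBC]; rewrite (eqfinE nAB) (eqfinE nBC).
Qed.

(** Membership of [x] in the polarized set depends only on [x] and its mirror image, so the
    exceptional points are at most doubled. *)
Lemma eqfin_polarization {R : realType} {a : R} {A B : set R} :
  eqfin A B -> eqfin (polarization a A) (polarization a B).
Proof.
move=> AB; apply: (eqfin_sub ((A `+` B) `|` reflection a @` (A `+` B))).
  by rewrite finite_setU; split => //; exact: finite_image.
move=> x /not_orP[nAB nE].
have nr : ~ (A `+` B) (reflection a x).
  by move=> ABx; apply: nE; exists (reflection a x) => //; rewrite /reflection; lra.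
by rewrite /polarization /=; rewrite (eqfinE nAB) (eqfinE nr).
Qed.

Notation polarize_seq := (foldl (fun B b => polarization b B)).

Lemma eqfin_polarize_seq {R : realType} {A B : set R} {t : seq R} :
  eqfin A B -> eqfin (polarize_seq A t) (polarize_seq B t).
Proof. by elim: t A B => //= a t IH A B /eqfin_polarization/IH. Qed.

Lemma eqfin_preimageN {R : realType} {A B : set R} :
  eqfin A B -> eqfin (-%R @^-1` A) (-%R @^-1` B).
Proof.
move=> AB; apply: (eqfin_sub (-%R @` (A `+` B))); first exact: finite_image.
move=> x nE; suff nAB : ~ (A `+` B) (- x) by rewrite /preimage /mkset (eqfinE nAB).
by move=> ABx; apply: nE; exists (- x) => //; rewrite opprK.
Qed.

Lemma polarize_seqN {R : realType} {A : set R} {t : seq R} :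
  all (fun a => a != 0) t ->
  polarize_seq (-%R @^-1` A) [seq - a | a <- t] = -%R @^-1` (polarize_seq A t).
Proof.
by elim: t A => //= a t IH A /andP[a0 /IH ht]; rewrite polarizationN// ht.
Qed.

(** * Polarizing intervals *)

(** A point below [a] is nearer to 0 than its mirror image, so a centered interval already has its
    mass on the preferred side. *)
Lemma polarization_itv {R : realType} {a h : R} : 0 < a ->
  polarization a `[- h, h]%classic = `[- h, h]%classic.
Proof.
move=> a0; apply/funext => x; apply/propext.
case: (ltgtP x a) => [xa|ax|->]; rewrite ?polarization_fix
  ?(polarization_lt _ a0 xa) ?(polarization_gt _ a0 ax)//= ?in_itv /=.
- by split=> [[//|]|]; [lra|left].
- by split=> [[//]|]; lra.
Qed.

(** The reflection about [(l + r) / 4] sends the midpoint [(l + r) / 2] to 0, hence [[l, r]] to the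
    centered interval. *)
Lemma center_itv {R : realType} {l r : R} : 0 < l + r ->
  polarization ((l + r) / 4) `[l, r]%classic = `[- ((r - l) / 2), (r - l) / 2]%classic.
Proof.
move=> lr; have a0 : 0 < (l + r) / 4 by lra.
apply/funext => x; apply/propext.
case: (ltgtP x ((l + r) / 4)) => [xa|ax|->]; rewrite ?polarization_fix
  ?(polarization_lt _ a0 xa) ?(polarization_gt _ a0 ax)//= ?in_itv /=.
- split=> [[/andP[? ?]|/andP[? ?]]|/andP[? ?]].
  + by apply/andP; split; lra.
  + by apply/andP; split; lra.
  + by right; apply/andP; split; lra.
- split=> [[/andP[? ?] /andP[? ?]]|/andP[? ?]].
  + by apply/andP; split; lra.
  + by split; apply/andP; split; lra.
- by split=> /andP[? ?]; apply/andP; split; lra.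
Qed.

(* The exceptional point is d, which is kept when its mirror image b is in B. *)
Lemma join_itv {R : realType} {B : set R} {b c d : R} :
  (forall x, B x -> x <= b) -> B b -> b < c -> c <= d -> 0 < b + d ->
  eqfin (polarization ((b + d) / 2) (B `|` `[c, d]%classic)) (B `|` `[b, b + d - c]%classic).
Proof.
move=> Bb BB bc cd bd; have a0 : 0 < (b + d) / 2 by lra.
apply: (eqfin_sub [set d]) => [|x]; first exact: finite_set1.
move=> /= /eqP xd.
case: (ltgtP x ((b + d) / 2)) => [xa|ax|->]; rewrite ?polarization_fix
  ?(polarization_lt _ a0 xa) ?(polarization_gt _ a0 ax)//= ?in_itv /=.
- split=> [[[Bx|/andP[? ?]]|[/Bb ?|/andP[? ?]]]|[Bx|/andP[? ?]]].
  + by left.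
  + by right; apply/andP; split; lra.
  + by lra.
  + by right; apply/andP; split; lra.
  + by left; left.
  + by right; right; apply/andP; split; lra.
- split=> [[[/Bb ?|/andP[? ?]] [/Bb ?|/andP[? ?]]]|[/Bb ?|/andP[? ?]]].
  + lra.
  + lra.
  + by have : x = d by [lra]; move/eqP; rewrite (negbTE xd).
  + by right; apply/andP; split; lra.
  + by lra.
  + by split; right; apply/andP; split; lra.
- split=> [[/Bb ?|/andP[? ?]]|[/Bb ?|/andP[? ?]]].
  + by lra.
  + by right; apply/andP; split; lra.
  + by lra.
  + by right; apply/andP; split; lra.
Qed.

(** * Sets centered by finitely many polarizations *)

(** The half-length [h] is tied to the measure of [A] itself, so the limit interval is the
    rearrangement of [A] up to its two ends. The value [h = 0] covers null sets. *)
Definition symmetrizable {R : realType} (A : set R) :=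
  exists (t : seq R) (h : R), [/\ all (fun a => a != 0) t, 0 <= h,
    lebesgue_measure A = (h *+ 2)%:E &
    eqfin (polarize_seq A t) `[- h, h]%classic].

Lemma symmetrizableN {R : realType} {A : set R} : measurable A ->
  symmetrizable (-%R @^-1` A) -> symmetrizable A.
Proof.
move=> mA [t [h [t0 h0 muA hA]]]; exists (map -%R t), h; split => //.
- by rewrite all_map; apply: sub_all t0 => a /=; rewrite oppr_eq0.
- by rewrite -muA; exact/esym/lebesgue_measureN.
have -> : A = -%R @^-1` (-%R @^-1` A).
  by apply/funext => x; rewrite /preimage /mkset opprK.
rewrite polarize_seqN//.
apply: eqfin_trans (eqfin_preimageN hA) _.
by rewrite opp_preimage_itvbndbnd/= opprK; exact: eqfin_refl.
Qed.

Lemma symmetrizable_polarization {R : realType} {A B : set R} (a : R) :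
  a != 0 -> eqfin (polarization a A) B ->
  lebesgue_measure A = lebesgue_measure B ->
  symmetrizable B -> symmetrizable A.
Proof.
move=> a0 AB mAB [t [h [t0 h0 muB hB]]]; exists (a :: t), h.
split; rewrite /= ?a0 ?mAB//.
exact: eqfin_trans (eqfin_polarize_seq AB) hB.
Qed.

Lemma symmetrizable_itv {R : realType} {l r : R} :
  l < r -> 0 <= l + r -> symmetrizable `[l, r]%classic.
Proof.
move=> lr; rewrite le_eqVlt => /predU1P[/esym/addr0_eq lrE|lr0].
  exists [::], r; split => //=; first lra.
    by rewrite lebesgue_measure_itv/= lte_fin lr -EFinD; congr _%:E; lra.
  by rewrite -lrE opprK; exact: eqfin_refl.
exists [:: (l + r) / 4], ((r - l) / 2); split => /=.
- by rewrite andbT gt_eqF//; lra.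
- by lra.
- by rewrite lebesgue_measure_itv/= lte_fin lr -EFinD; congr _%:E; lra.
- by rewrite center_itv//; exact: eqfin_refl.
Qed.

(** * Finite unions of closed intervals *)

(* Overlapping, unsorted and degenerate intervals are allowed. *)
Definition itvs {R : realType} (s : seq (R * R)) : set R :=
  [set x | has (fun p => p.1 <= x <= p.2) s].

Lemma itvs_nil {R : realType} : itvs [::] = set0 :> set R.
Proof. by apply/seteqP; split. Qed.

Lemma itvs_cons {R : realType} (p : R * R) (s : seq (R * R)) :
  itvs (p :: s) = itvs s `|` `[p.1, p.2]%classic.
Proof.
apply/seteqP; split => x; rewrite /itvs /= ?in_itv /=.
  by case/orP; [right|left].
by case=> ->; rewrite ?orbT.
Qed.

Lemma itvsP {R : realType} {s : seq (R * R)} {x : R} : itvs s x ->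
  exists2 p, p \in s & p.1 <= x <= p.2.
Proof. by move/hasP. Qed.

Lemma mem_itvs {R : realType} {s : seq (R * R)} {p : R * R} {x : R} :
  p \in s -> p.1 <= x <= p.2 -> itvs s x.
Proof. by move=> ps px; apply/hasP; exists p. Qed.

Lemma perm_itvs {R : realType} {s t : seq (R * R)} :
  perm_eq s t -> itvs s = itvs t.
Proof. by move=> st; apply/funext => x; rewrite /itvs /= (perm_has _ st). Qed.

Lemma itvs_cat {R : realType} (s t : seq (R * R)) :
  itvs (s ++ t) = itvs s `|` itvs t.
Proof.
apply/funext => x; apply/propext; rewrite /itvs /= has_cat.
by split => [/orP|/orP].
Qed.

Lemma measurable_itvs {R : realType} (s : seq (R * R)) : measurable (itvs s).
Proof.
elim: s => [|p s IH]; first by rewrite itvs_nil; exact: measurable0.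
by rewrite itvs_cons; apply: measurableU.
Qed.

Definition flip_itv {R : realType} (p : R * R) : R * R := (- p.2, - p.1).

Lemma preimageN_itvs {R : realType} (s : seq (R * R)) :
  -%R @^-1` itvs s = itvs (map flip_itv s).
Proof.
apply/funext => x; rewrite /itvs /preimage /mkset has_map; congr is_true.
by apply: eq_has => p /=; rewrite andbC lerNr lerNl.
Qed.

(** A degenerate interval is just its left end, so the left ends contain all points that are
    lost. *)
Lemma eqfin_itvs_nondegenerate {R : realType} (s : seq (R * R)) :
  eqfin (itvs s) (itvs [seq p <- s | p.1 < p.2]).
Proof.
apply: (eqfin_sub [set` map fst s]) => [|x /= xs].
  by apply/finite_seqP; exists (map fst s).
split=> [/itvsP[p ps /andP[px xp]]|].
  apply: (@mem_itvs _ _ p); last by rewrite px.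
  rewrite mem_filter ps andbT lt_neqAle (le_trans px xp) andbT.
  apply/eqP => pE; apply: xs; apply/mapP; exists p => //.
  by apply/eqP; rewrite eq_le px {1}pE xp.
by move=> /itvsP[p]; rewrite mem_filter => /andP[_ ps] px; exact: mem_itvs px.
Qed.

(* [measureU] retyped so that its right-hand side shows [lebesgue_measure]
   instead of the coercion of a content, which blocks later rewriting. *)
Lemma lebesgue_measureU {R : realType} {A B : set R} :
  measurable A -> measurable B -> A `&` B = set0 ->
  lebesgue_measure (A `|` B) = (lebesgue_measure A + lebesgue_measure B)%E.
Proof. by move=> *; rewrite measureU. Qed.

Lemma lebesgue_measure_slide {R : realType} {B : set R} {b c d : R} :
  measurable B -> (forall x, B x -> x <= b) -> B b -> b < c -> c < d ->
  lebesgue_measure (B `|` `[c, d]%classic) =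
  lebesgue_measure (B `|` `[b, b + d - c]%classic).
Proof.
move=> mB Bb BB bc cd.
(* The slid interval meets [B] at [b]; opening it there makes the union disjoint. *)
have -> : B `|` `[b, b + d - c]%classic = B `|` `]b, b + d - c]%classic.
  apply/seteqP; split=> x /= [Bx|]; try by left.
    rewrite !in_itv /= le_eqVlt => /andP[/predU1P[<-|->] //]; first by left.
    by move=> ->; right.
  by rewrite !in_itv /= => /andP[/ltW-> ->]; right.
rewrite !lebesgue_measureU//; last 2 first.
- by apply/seteqP; split=> x //= [/Bb]; rewrite in_itv/= => ? /andP[? ?]; lra.
- by apply/seteqP; split=> x //= [/Bb]; rewrite in_itv/= => ? /andP[? ?]; lra.
rewrite !lebesgue_measure_itv/= !lte_fin cd; rewrite (_ : b < b + d - c); last lra.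
by congr (_ + _)%E; rewrite -!EFinB; congr _%:E; lra.
Qed.

(** * Induction on the number of intervals *)

Lemma seq_argmax {R : realType} {T : eqType} (f : T -> R) (x : T) (s : seq T) :
  exists2 p, p \in x :: s & forall q, q \in x :: s -> f q <= f p.
Proof.
elim: s => [|y s [p ps pmax]].
  by exists x => [|q]; rewrite inE// => /eqP->.
have [yp|py] := leP (f y) (f p).
  exists p => [|q].
    by move: ps; rewrite !inE => /orP[->|->]; rewrite ?orbT.
  rewrite !inE orbCA => /orP[/eqP->//|qs]; apply: pmax.
  by rewrite inE.
exists y => [|q]; first by rewrite !inE eqxx orbT.
rewrite !inE orbCA => /orP[/eqP->//|qs]; apply/ltW/le_lt_trans/py/pmax.
by rewrite inE.
Qed.

(** The induction step when [p] has the rightmost end and that end is at least [- q.1] for every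
    left end [q.1]. The rightmost interval is absorbed into the one of the rest that ends last, at
    [b], after a slide if there is a gap. *)
Lemma symmetrizable_join {R : realType} {n : nat} :
  (forall s : seq (R * R), size s = n -> all (fun p => p.1 < p.2) s ->
    symmetrizable (itvs s)) ->
  forall (s : seq (R * R)) (p : R * R), size s = n.+1 ->
    all (fun p => p.1 < p.2) s -> p \in s ->
    (forall q, q \in s -> q.2 <= p.2 /\ 0 <= q.1 + p.2) ->
  symmetrizable (itvs s).
Proof.
move=> IH s [c d] sn ltS ps pmax; have [_ cd0] := pmax _ ps.
have sE := perm_to_rem ps; rewrite (perm_itvs sE).
move: ltS (perm_size sE); rewrite (perm_all _ sE) sn /= => /andP[cd ltS] [].
have {}pmax q : q \in rem (c, d) s -> q.2 <= d /\ 0 <= q.1 + d.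
  by move/mem_rem/pmax.
case: (rem _ _) pmax ltS => [_ _ _|q0 r pmax ltS rn].
  by rewrite itvs_cons itvs_nil set0U; exact: symmetrizable_itv.
have [[c' b] qr qmax] := seq_argmax snd q0 r.
have [/= bd c'd] := pmax _ qr.
move: (rem _ _) (perm_to_rem qr) => r' rE; rewrite (perm_all _ rE) /= in ltS.
rewrite (perm_size rE) /= in rn; move: ltS => /andP[/= c'b ltS].
have {}qmax x : itvs ((c', b) :: r') x -> x <= b.
  rewrite -(perm_itvs rE) => /itvsP[q /qmax /= qb /andP[_ /le_trans]].
  exact.
rewrite itvs_cons (perm_itvs rE).
(* Without a gap the two intervals merge into their hull and no polarization is spent. *)
have [cb|bc] := leP c b.
  have -> : itvs ((c', b) :: r') `|` `[(c, d).1, (c, d).2]%classic =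
      itvs ((Num.min c c', d) :: r').
    rewrite -itvs_cons; apply/funext => x; rewrite /itvs /= orbA.
    congr is_true; congr orb; rewrite ge_min.
    apply/idP/idP => [/orP[]/andP[? ?]|/andP[/orP[?|?] ?]].
    - by apply/andP; split; [apply/orP; left|]; lra.
    - by apply/andP; split; [apply/orP; right|]; lra.
    - by apply/orP; left; lra.
    - by apply/orP; have [?|?] := leP x b; [right|left]; lra.
  by apply: IH; rewrite /= -?rn// ltS andbT gt_min cd.
(* Strict because [c' < b] and [0 <= c' + d]; this keeps the center [(b + d) / 2] positive. *)
have bd0 : 0 < b + d by lra.
have Bb : itvs ((c', b) :: r') b.
  by apply: (mem_itvs (mem_head _ _)) => /=; rewrite ltW/=.
(* The slid interval starts at [b], where [[c', b]] ends, so the two form one interval. *)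
have uE : itvs ((c', b + d - c) :: r') =
    itvs ((c', b) :: r') `|` `[b, b + d - c]%classic.
  rewrite [in RHS](_ : `[b, b + d - c]%classic =
    `[(b, b + d - c).1, (b, b + d - c).2]%classic)// -itvs_cons.
  apply/funext => x; rewrite /itvs /= orbA; congr is_true; congr orb.
  by apply/idP/idP => [?|/orP[] ?]; lra.
apply: (@symmetrizable_polarization _ _ (itvs ((c', b + d - c) :: r'))
  ((b + d) / 2)); last by apply: IH; rewrite /= -?rn// ltS andbT; lra.
- by rewrite gt_eqF//; lra.
- by rewrite uE; apply: join_itv => //; exact: ltW.
- by rewrite uE; apply: lebesgue_measure_slide => //; exact: measurable_itvs.
Qed.

Lemma symmetrizable_itvs {R : realType} (s : seq (R * R)) :
  all (fun p => p.1 < p.2) s -> symmetrizable (itvs s).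
Proof.
move: {2}(size s) (erefl (size s)) => n; elim: n s => [|n IH] s sn ltS.
  (* The empty set differs from [[0, 0]] by one point. *)
  rewrite (size0nil sn) itvs_nil; exists [::], 0; split => //=.
    by rewrite measure0 mul0rn.
  by rewrite oppr0 set_itv1 /eqfin set0Y; exact: finite_set1.
case: s sn ltS => // p0 s sn ltS.
have [p ps pmax] := seq_argmax snd p0 s.
have [q qs qmin] := seq_argmax (fun q => - q.1) p0 s.
(* With [q.1] the leftmost and [p.2] the rightmost end, the sign of the sum tells which side reaches
   farther from 0; if it is the left, the mirror image is treated. *)
have [qp|pq] := leP 0 (q.1 + p.2).
  apply: (symmetrizable_join IH _ _ sn ltS ps) => r rs; split; first exact: pmax.
  by have := qmin _ rs; lra.
apply: symmetrizableN; first exact: measurable_itvs.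
rewrite preimageN_itvs; apply: (symmetrizable_join IH _ _ _ _ (map_f flip_itv qs)).
- by rewrite size_map.
- by rewrite all_map; apply: sub_all ltS => -[l r] /=; rewrite ltrN2.
- move=> _ /mapP[r rs ->]; rewrite /flip_itv /=.
  by split; [exact: qmin|have := pmax _ rs; lra].
Qed.

(** * Gaps of a closed bounded set *)

Definition gap {R : realType} (A : set R) (b c : R) :=
  [/\ A b, A c, b < c & forall x, b < x < c -> ~ A x].

(** The left end determines the gap, so counting gaps amounts to counting these reals. *)
Definition gap_starts {R : realType} (A : set R) : set R :=
  [set b | exists c, gap A b c].

Lemma closed_has_max {R : realType} {A : set R} : closed A -> A !=set0 ->
  has_ubound A -> exists2 M, A M & forall x, A x -> x <= M.
Proof.
move=> cA A0 uA; exists (sup A); first exact/cA/closure_sup.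
by move=> x Ax; exact: ub_le_sup.
Qed.

Lemma closed_has_min {R : realType} {A : set R} : closed A -> A !=set0 ->
  has_lbound A -> exists2 m, A m & forall x, A x -> m <= x.
Proof.
move=> cA [x Ax] [l lA].
have cN : closed (-%R @^-1` A).
  by apply: preimage_closed => // y _; exact: opp_continuous.
have [||M AM leM] := closed_has_max cN.
- by exists (- x); rewrite /= opprK.
- by exists (- l) => y /lA; rewrite lerNr.
- by exists (- M) => // y Ay; rewrite lerNl; apply: leM; rewrite /= opprK.
Qed.

(** Induction on a list containing all gap starts: cutting [A] at a gap gives two closed pieces that
    have no new gap and have lost this one. A nonempty set without gaps fills the interval between
    its extremes. *)
Lemma closed_itvs {R : realType} {A : set R} {s : seq R} : closed A ->
  has_ubound A -> has_lbound A -> gap_starts A `<=` [set` s] ->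
  exists t, A = itvs t.
Proof.
elim: s A => [|b s IH] A cA uA lA gA.
  have [->|/set0P A0] := eqVneq A set0; first by exists [::]; rewrite itvs_nil.
  have [m Am mA] := closed_has_min cA A0 lA.
  have [M AM MA] := closed_has_max cA A0 uA.
  exists [:: (m, M)]; rewrite itvs_cons itvs_nil set0U.
  apply/seteqP; split => x /=; rewrite in_itv /=.
    by move=> Ax; rewrite mA// MA.
  case/andP => mx xM; apply: contrapT => nAx.
  (* The points of [A] nearest to the missing point [x] on either side bound a gap. *)
  have [|||b [Ab /= bx] bmax] := @closed_has_max _ (A `&` [set y | y <= x]).
  - by apply: closedI => //; exact: closed_le.
  - by exists m.
  - by exists x => y [].
  have [|||c [Ac /= xc] cmin] := @closed_has_min _ (A `&` [set y | x <= y]).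
  - by apply: closedI => //; exact: closed_ge.
  - by exists M.
  - by exists x => y [].
  have {}bx : b < x by rewrite lt_neqAle bx andbT; apply/eqP => bE; rewrite bE in Ab.
  have {}xc : x < c by rewrite lt_neqAle xc andbT; apply/eqP => cE; rewrite cE in nAx.
  suff /gA : gap_starts A b by [].
  exists c; split=> // [|y /andP[byy yc] Ay]; first exact: lt_trans xc.
  have [yx|xy] := leP y x.
    by have := bmax _ (conj Ay yx); lra.
  by have := cmin _ (conj Ay (ltW xy)); lra.
(* A listed point that starts no gap is dropped from the list. *)
have [[c [Ab Ac bc nA]]|nb] := pselect (gap_starts A b); last first.
  apply: IH => // x xA; have := gA _ xA; rewrite /= inE => /predU1P[xb|//].
  by rewrite xb in xA.
have [||||t1 E1] := IH (A `&` [set y | y <= b]).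
- by apply: closedI => //; exact: closed_le.
- by exists b => y [].
- by case: lA => l lA; exists l => y [/lA].
- move=> x [d [[Ax /= xb] [Ad /= db] xd nAd]].
  have /gA/= : gap_starts A x.
    exists d; split => // y xyd Ay; apply: (nAd _ xyd); split => //=.
    by move: xyd => /andP[_ yd]; lra.
  by rewrite inE => /predU1P[xbE|//]; lra.
have [||||t2 E2] := IH (A `&` [set y | c <= y]).
- by apply: closedI => //; exact: closed_ge.
- by case: uA => l lA'; exists l => y [/lA'].
- by exists c => y [].
- move=> x [d [[Ax /= xb] [Ad /= db] xd nAd]].
  have /gA/= : gap_starts A x.
    exists d; split => // y xyd Ay; apply: (nAd _ xyd); split => //=.
    by move: xyd => /andP[xy _]; lra.
  by rewrite inE => /predU1P[xbE|//]; lra.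
exists (t1 ++ t2); rewrite itvs_cat -E1 -E2 -setIUr.
apply/seteqP; split => [x Ax|x []//]; split => //=.
have [xb|bx] := leP x b; first by left.
right; rewrite leNgt; apply/negP => xc.
by apply: (nA x) => //; rewrite bx.
Qed.

(** * The perimeter bounds the number of gaps *)

Lemma gap_starts_sep {R : realType} {A : set R} {s : seq R} :
  (forall b, b \in s -> gap_starts A b) ->
  exists2 e, 0 < e & forall b x, b \in s -> b < x < b + e -> ~ A x.
Proof.
elim: s => [|b s IH] sA; first by exists 1.
have [|e e0 eP] := IH; first by move=> x xs; apply: sA; rewrite inE xs orbT.
have [c [Ab Ac bc nA]] := sA _ (mem_head _ _).
exists (Num.min e (c - b)); first by rewrite lt_min e0 subr_gt0.
move=> b' x; rewrite inE => /predU1P[->|b's] /andP[bx].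
  rewrite -ltrBlDl lt_min => /andP[_ xc]; apply: nA; rewrite bx /=; lra.
by rewrite -ltrBlDl lt_min => /andP[xe _]; apply: (eP b') => //; rewrite bx /=; lra.
Qed.

(** The intervals []b, b + e[] avoid [A], and they avoid each other: if two met, the larger of their
    left ends, a point of [A], would lie in the other interval. *)
Lemma lebesgue_measure_thicken {R : realType} {A : set R} {s : seq R} {e : R} :
  measurable A -> 0 < e -> uniq s -> (forall b, b \in s -> A b) ->
  (forall b x, b \in s -> b < x < b + e -> ~ A x) ->
  let U := A `|` [set x | has (fun b => b < x < b + e) s] in
  measurable U /\
  lebesgue_measure U = (lebesgue_measure A + (e *+ size s)%:E)%E.
Proof.
move=> mA e0; elim: s => [|b s IH] /=.
  move=> _ _ _; rewrite (_ : [set x | false] = set0) ?setU0 ?mulr0n ?adde0//.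
  by apply/seteqP; split.
move=> /andP[bs us] sA sep.
have [||mU muU] := IH us.
- by move=> x xs; apply: sA; rewrite inE xs orbT.
- by move=> x y xs; apply: sep; rewrite inE xs orbT.
have -> : A `|` [set x | (b < x < b + e) || has (fun b => b < x < b + e) s] =
    (A `|` [set x | has (fun b => b < x < b + e) s]) `|` `]b, b + e[%classic.
  apply/seteqP; split => x /=; rewrite in_itv /=.
    by case=> [|/orP[]]; by [left; left|right|left; right].
  by case=> [[|->]|->]; [left|rewrite orbT; right|right].
split; first by apply: measurableU.
rewrite lebesgue_measureU// ?muU.
  rewrite lebesgue_measure_itv/= lte_fin ltrDl e0 -addeA -EFinB -EFinD.
  by congr (_ + _%:E)%E; rewrite mulrS; lra.
have sepb := sep b _ (mem_head _ _).
have Ab := sA b (mem_head _ _).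
apply/seteqP; split => x //= [+ ]; rewrite in_itv /= => + bxe.
case=> [/sepb|/hasP[b' b's b'x]]; first exact.
have b's' : b' \in b :: s by rewrite inE b's orbT.
have [bb'|b'b|bE] := ltgtP b b'; last by rewrite bE b's in bs.
  by apply: (sepb b'); [lra|exact: sA].
by apply: (sep b' b b's' _ Ab); lra.
Qed.

Lemma open_nbhd_open {R : realType} (A : set R) (e : R) : open (open_nbhd A e).
Proof.
rewrite (_ : open_nbhd A e = edist_inf A @^-1` [set y | (y < e%:E)%E])//.
apply: open_comp => [x _|]; first exact: edist_inf_continuous.
exact: open_ereal_lt_ereal.
Qed.

Lemma sub_open_nbhd {R : realType} {A : set R} {e : R} : 0 < e ->
  A `<=` open_nbhd A e.
Proof. by move=> e0 x Ax; rewrite /open_nbhd /= edist_inf0// lte_fin. Qed.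

Lemma open_nbhd_dist {R : realType} {A : set R} {e b x : R} : A b ->
  `|x - b| < e -> open_nbhd A e x.
Proof.
move=> Ab xb; rewrite /open_nbhd /=.
apply: (@le_lt_trans _ _ (edist (x, b))).
  by apply: ereal_inf_lbound; exists b.
(* [edist_fin] gives only a weak bound, so a radius strictly between the distance and [e] is
   used. *)
have r0 : 0 < (`|x - b| + e) / 2 by have := normr_ge0 (x - b); lra.
apply: (le_lt_trans (edist_fin r0 _)); last by rewrite lte_fin; lra.
by rewrite /ball /=; lra.
Qed.

(** For small [e] the neighborhood contains [A] and a disjoint interval of length [e] to the right
    of each gap start. *)
Lemma perimeter_quotient_ge {R : realType} {A : set R} {s : seq R} :
  measurable A -> (lebesgue_measure A \is a fin_num) -> uniq s ->
  (forall b, b \in s -> gap_starts A b) ->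
  \forall e \near 0^'+, ((size s)%:R%:E <= perimeter_quotient A e)%E.
Proof.
move=> mA fA us sA; have [d d0 dP] := gap_starts_sep sA.
near=> e.
have e0 : 0 < e by near: e; exact: nbhs_right_gt.
have ed : e < d by near: e; exact: nbhs_right_lt.
have AE b : b \in s -> A b by move=> /sA[c []].
have [|mU muU] := lebesgue_measure_thicken mA e0 us AE.
  by move=> b x bs bx; apply: (dP b) => //; lra.
rewrite /perimeter_quotient lee_pdivlMl// leeBrDl// -EFinM mulr_natr -muU.
apply: le_measure; rewrite ?inE//.
  by apply: open_measurable; exact: open_nbhd_open.
move=> x [/(sub_open_nbhd e0)//|/= /hasP[b /AE Ab bx]].
by apply: (open_nbhd_dist Ab); rewrite ltr_distl; lra.
Unshelve. all: by end_near. Qed.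

Lemma finite_gap_starts {R : realType} {A : set R} : measurable A ->
  lebesgue_measure A \is a fin_num -> finite_perimeter A ->
  finite_set (gap_starts A).
Proof.
move=> mA fA [cvA fP]; apply: contrapT => infA.
pose p := fine (minkowski_perimeter A).
(* Infinitely many gaps would supply more gap starts than the finite perimeter allows. *)
have [X XA cX] := infinite_set_fset (Num.bound `|p|) infA.
have : ((Num.bound `|p|)%:R%:E <= minkowski_perimeter A)%E.
  apply: lime_ge => //; near=> e.
  apply: (@le_trans _ _ (size (finmap.enum_fset X))%:R%:E).
    by rewrite lee_fin ler_nat.
  near: e; apply: perimeter_quotient_ge => //; exact: finmap.fset_uniq.
rewrite -(fineK fP) lee_fin leNgt => /negP; apply.
by apply: le_lt_trans (ler_norm _) _; exact/archi_boundP/normr_ge0.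
Unshelve. all: by end_near. Qed.

Lemma minkowski_perimeter_ge0 {R : realType} {A : set R} : measurable A ->
  lebesgue_measure A \is a fin_num -> finite_perimeter A ->
  0 <= fine (minkowski_perimeter A).
Proof.
move=> mA fA [cvA fP]; rewrite fine_ge0//; apply: lime_ge => //.
(* The empty list of gaps gives the lower bound 0. *)
exact: (@perimeter_quotient_ge _ _ [::]).
Qed.

(** * Null differences and the infinite sequence of reflections *)

(** Both measures equal that of the union, which adds only finitely many points to either set. *)
Lemma eqfin_lebesgue_measure {R : realType} {A B : set R} :
  measurable A -> measurable B -> eqfin A B ->
  lebesgue_measure A = lebesgue_measure B.
Proof.
move=> mA mB; rewrite /eqfin setY_def finite_setU => -[fAB fBA].
have leU (C D : set R) : measurable C -> measurable D ->
    finite_set (D `\` C) -> lebesgue_measure (C `|` D) = lebesgue_measure C.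
  move=> mC mD /finite_set_countable/countable_lebesgue_measure0 DC0.
  rewrite (_ : C `|` D = C `|` (D `\` C)).
    by rewrite lebesgue_measureU ?DC0 ?adde0 ?setDIK//; exact: measurableD.
  apply/seteqP; split => x /=; [|tauto].
  by have [] := pselect (C x); tauto.
by rewrite -(leU A B)// setUC leU.
Qed.

Lemma polarizations_take {R : realType} (A : set R) (t : seq R) (n : nat) :
  (n <= size t)%N ->
  polarizations (nth 1 t) A n = polarize_seq A (take n t).
Proof.
elim: n => [|n IH] nt; first by rewrite take0.
by rewrite (take_nth 1)// -cats1 foldl_cat /= IH// ltnW.
Qed.

(** Past the end of [t] the default value 1 of [nth] supplies the centers, and reflecting about 1
    leaves the centered interval fixed. *)
Lemma polarizations_eqfin_itv {R : realType} {A : set R} {t : seq R} {h : R} :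
  eqfin (polarize_seq A t) `[- h, h]%classic ->
  forall n, (size t <= n)%N ->
  eqfin (polarizations (nth 1 t) A n) `[- h, h]%classic.
Proof.
move=> tA n /subnK <-; elim: (n - size t)%N => [|k IH].
  by rewrite add0n polarizations_take// take_size.
rewrite addSn /= nth_default ?leq_addl//.
by rewrite -(@polarization_itv _ 1 h)//; exact: eqfin_polarization.
Qed.

Theorem theorem5 (R : realType) (L : R) (hL : 0 < L) (A : set R)
    (cA : compact A) (AL : A `<=` [set x | `|x| < L])
    (PA : finite_perimeter A) :
  exists a : nat -> R,
    (forall i, a i != 0) /\
    exists N : nat, forall n : nat, (N <= n)%N ->
      (lebesgue_measure (polarizations a A n `+` sym_rearrangement A) <=
       ((fine (minkowski_perimeter A) /
         (1 + fine (minkowski_perimeter A))) ^+ n)%:E)%E.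
Proof.
have clA : closed A by apply: compact_closed => //; exact: Rhausdorff.
have mA : measurable A by exact: closed_measurable.
have fA : lebesgue_measure A \is a fin_num by rewrite ge0_fin_numE// compact_finite_measure.
have P0 := minkowski_perimeter_ge0 mA fA PA.
have /finite_seqP[u uE] := finite_gap_starts mA fA PA.
have [|||s0 As] := @closed_itvs _ A u clA.
- by exists L => x /AL /=; rewrite ltr_norml => /andP[_ /ltW].
- by exists (- L) => x /AL /=; rewrite ltr_norml => /andP[/ltW].
- by rewrite uE.
pose s := [seq p <- s0 | p.1 < p.2].
have Es : eqfin A (itvs s) by rewrite As; exact: eqfin_itvs_nondegenerate.
have [t [h [t0 h0 mus ht]]] := symmetrizable_itvs s (filter_all _ _).
have muA : lebesgue_measure A = (h *+ 2)%:E.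
  by rewrite (eqfin_lebesgue_measure mA (measurable_itvs s) Es).
exists (nth 1 t); split => [i|].
  have [it|ti] := ltnP i (size t); first exact: (allP t0 _ (mem_nth _ it)).
  by rewrite nth_default// oner_neq0.
(* From here on the symmetric difference is finite, so the left side is 0 and the bound only has to
   be nonnegative. *)
exists (size t) => n tn; rewrite countable_lebesgue_measure0; last first.
  apply: finite_set_countable.
  apply: (eqfin_trans (polarizations_eqfin_itv
    (eqfin_trans (eqfin_polarize_seq Es) ht) n tn)).
  (* The rearrangement is the open interval []-h, h[], which lacks only the two ends. *)
  apply: (eqfin_sub [set - h; h]) => [|x].
    by rewrite finite_setU; split; exact: finite_set1.
  move=> /= /not_orP[/eqP xNh /eqP xh].
  rewrite in_itv /= /sym_rearrangement /= muA lte_fin ltr_pMn2r// ltr_norml.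
  by rewrite !lt_neqAle eq_sym xNh xh.
by rewrite lee_fin exprn_ge0// divr_ge0// addr_ge0.
Qed.
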